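(* Let $X$ be a Hausdorff space and let $\tau^c$ be the family of all closed subsets of $X$. Let $Y$ be a Hausdorff space with a strictly increasing closed cover $\{B_n\}_{n\in\mathbb N}$. Then $X$ is stratifiable if and only if there exists a map $\phi:\tau^c\to\mathcal L(X,\mathcal F(Y))$, $F\mapsto\phi_F$, such that: (i) for each $F\in\tau^c$, $F=\bigcap_{n\in\mathbb N}\phi_F^{-1}[Y\setminus B_n]$; (ii) if $F_1,F_2\in\tau^c$ and $F_1\subset F_2$, then $\phi_{F_1}(x)\subset\phi_{F_2}(x)$ for all $x\in X$; (iii) for each $F\in\tau^c$, $\phi_F$ is locally bounded on $X\setminus F$.
   Context: $\mathbb N$ is the set of positive integers. A sequence $\{B_n\}_{n\in\mathbb N}$ of closed subsets of a space $Y$ is a strictly increasing closed cover of $Y$ if $Y=\bigcup_{n}B_n$, $B_1\neq\emptyset$ and $B_n\subsetneq B_{n+1}$ for each $n$. $\mathcal F(Y)$ is the family of nonempty closed subsets of $Y$. For a set-valued map $\psi:X\to\mathcal F(Y)$ and $B\subset Y$, $\psi^{-1}[B]=\{x\in X:\psi(x)\cap B\neq\emptyset\}$ and $\psi^{\#}[B]=\{x\in X:\psi(x)\subset B\}$. $\psi$ is lower semi-continuous if $\psi^{-1}[V]$ is open in $X$ for each open $V\subset Y$; $\mathcal L(X,\mathcal F(Y))$ is the set of all lower semi-continuous maps $X\to\mathcal F(Y)$. $\psi$ is bounded on $A\subset X$ if $A\subset\psi^{\#}[B_n]$ for some $n\in\mathbb N$; $\psi$ is locally bounded at $x\in X$ if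 there is a neighborhood $O$ of $x$ such that $\psi$ is bounded on $O$; $\psi$ is locally bounded on $A\subset X$ if it is locally bounded at each $x\in A$. A space $X$ with topology $\tau$ is stratifiable if there is a map $\rho:\mathbb N\times\tau^c\to\tau$ such that (1) $F=\bigcap_{n\in\mathbb N}\rho(n,F)=\bigcap_{n\in\mathbb N}\overline{\rho(n,F)}$ for each $F\in\tau^c$; (2) if $F,H\in\tau^c$ and $F\subset H$, then $\rho(n,F)\subset\rho(n,H)$ for all $n\in\mathbb N$. *)

(* Defs.v *)
From HB Require Import structures.
From mathcomp Require Import all_boot all_order.
From mathcomp Require Import all_classical.
From mathcomp Require Import topology.

Set Implicit Arguments.
Unset Strict Implicit.
Unset Printing Implicit Defensive.

Local Open Scope classical_set_scope.

(* All sequences indexed by the positive integers are reindexed by nat: the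
   term of rank n here is the term of rank n + 1 in the usual numbering. *)

Record closed_set (T : topologicalType) := ClosedSet {
  closed_set_val :> set T;
  closed_setP : closed closed_set_val
}.

Record open_set (T : topologicalType) := OpenSet {
  open_set_val :> set T;
  open_setP : open open_set_val
}.

Record nonempty_closed_set (T : topologicalType) := NonemptyClosedSet {
  nonempty_closed_set_val :> set T;
  nonempty_closed_set_closed : closed nonempty_closed_set_val;
  nonempty_closed_set_neq0 : nonempty_closed_set_val !=set0
}.

(* [A `<` B] is proper inclusion. *)
Definition strictly_increasing_closed_cover (Y : topologicalType)
    (B : nat -> set Y) : Prop :=
  [/\ forall n, closed (B n),
      \bigcup_n B n = setT,
      B 0%N !=set0
    & forall n, B n `<` B n.+1].

Definition meet_preimage (X Y : topologicalType)
    (psi : X -> nonempty_closed_set Y) (B : set Y) : set X :=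
  [set x | psi x `&` B !=set0].

Definition sub_preimage (X Y : topologicalType)
    (psi : X -> nonempty_closed_set Y) (B : set Y) : set X :=
  [set x | psi x `<=` B].

Definition set_valued_lsc (X Y : topologicalType)
    (psi : X -> nonempty_closed_set Y) : Prop :=
  forall V : set Y, open V -> open (meet_preimage psi V).

Record lsc_map (X Y : topologicalType) := LscMap {
  lsc_map_fun :> X -> nonempty_closed_set Y;
  lsc_mapP : set_valued_lsc lsc_map_fun
}.

Definition bounded_map_on (X Y : topologicalType) (B : nat -> set Y)
    (psi : X -> nonempty_closed_set Y) (A : set X) : Prop :=
  exists n, A `<=` sub_preimage psi (B n).

Definition locally_bounded_map_at (X Y : topologicalType) (B : nat -> set Y)
    (psi : X -> nonempty_closed_set Y) (x : X) : Prop :=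
  exists2 O : set X, nbhs x O & bounded_map_on B psi O.

Definition locally_bounded_map_on (X Y : topologicalType) (B : nat -> set Y)
    (psi : X -> nonempty_closed_set Y) (A : set X) : Prop :=
  forall x, A x -> locally_bounded_map_at B psi x.

Definition stratifiable (X : topologicalType) : Prop :=
  exists rho : nat -> closed_set X -> open_set X,
    (forall F : closed_set X,
        (F : set X) = \bigcap_n (rho n F : set X) /\
        (F : set X) = \bigcap_n closure (rho n F)) /\
    (forall F H : closed_set X, F `<=` H -> forall n, rho n F `<=` rho n H).

(* Main.v *)
Require Import Defs.
From HB Require Import structures.
From mathcomp Require Import all_boot all_order.
From mathcomp Require Import all_classical.
From mathcomp Require Import topology.

Set Implicit Arguments.
Unset Strict Implicit.
Unset Printing Implicit Defensive.

Local Open Scope classical_set_scope.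

(** A stratification [rho] and a family [phi] of set-valued maps encode the same
    data: how deep a point [x] lies inside the neighbourhoods [rho n F] of [F]
    is recorded by how far up the cover [B] the value [phi F x] reaches.

    From [rho] to [phi], the value at [x] is the union of the [B k] over those
    [k] such that [x] survives the first [k] neighbourhoods of [F]
    ([stratum_value]).  If [x] lies in [F] this is all of [Y], which no [B n]
    contains because the cover is strictly increasing.  If [x] misses
    [rho n F], the value is inside [B n]; when [x] even misses the closure of
    [rho n F], this bound holds on a neighbourhood of [x], which is local
    boundedness.  Lower semi-continuity holds because surviving finitely many
    open sets is an open condition ([stratum_value_lsc]).

    From [phi] to [rho], one takes for [rho n F] the set of points at which
    [phi F] leaves [B n].  It is open by lower semi-continuity, and a bound
    by [B n] on a neighbourhood of [x] says exactly that this neighbourhood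
    misses [rho n F], so that [x] is outside its closure. *)

Lemma increasing_cover_le (Y : topologicalType) (B : nat -> set Y) :
  strictly_increasing_closed_cover B ->
  forall m n, (m <= n)%N -> B m `<=` B n.
Proof.
move=> [_ _ _ Blt] m n /subnK <-; elim: (n - m)%N => [|k IHk] //.
by apply: subset_trans IHk _; rewrite addSn; case: (Blt (k + m)%N).
Qed.

Section StratumValue.
Variables (X Y : topologicalType) (B : nat -> set Y).
Hypothesis hB : strictly_increasing_closed_cover B.
Variable U : nat -> set X.

(** Asking for all [i < k] replaces [U] by the decreasing sequence of its
    finite intersections; the case [k = 0] puts [B 0] inside every value, which
    makes it nonempty. *)
Definition stratum_value (x : X) : set Y :=
  [set y | exists2 k, forall i, (i < k)%N -> U i x & B k y].

Lemma stratum_value_full x : (forall n, U n x) -> stratum_value x = setT.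
Proof.
case: (hB) => _ BT _ _ Ux; rewrite -subTset -BT => y [k _ Bky].
by exists k => // i _.
Qed.

Lemma stratum_value_sub n x : ~ U n x -> stratum_value x `<=` B n.
Proof.
move=> nUx y [k Uk]; apply: (increasing_cover_le hB).
by rewrite leqNgt; apply/negP => /Uk.
Qed.

(** Off the intersection of the [U n], the value is the single term [B m] at
    the first [m] such that [U m] misses the point. *)
Lemma stratum_value_closed x : closed (stratum_value x).
Proof.
case: (hB) => Bcl _ _ _.
have [Ux|/existsNP exN] := pselect (forall n, U n x).
  by rewrite stratum_value_full //; exact: closedT.
have exb : exists n, ~~ `[< U n x >] by case: exN => n /asboolPn; exists n.
have [m /asboolPn nUm m_min] := ex_minnP exb.
suff -> : stratum_value x = B m by exact: Bcl.
apply/seteqP; split; first exact: stratum_value_sub.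
move=> y Bmy; exists m => // i lt_im.
by apply: contrapT => /asboolPn /m_min; rewrite leqNgt lt_im.
Qed.

Lemma stratum_value_neq0 x : stratum_value x !=set0.
Proof. by case: (hB) => _ _ [y B0y] _; exists y; exists 0%N. Qed.

Definition stratum_closed_value (x : X) : nonempty_closed_set Y :=
  NonemptyClosedSet (@stratum_value_closed x) (stratum_value_neq0 x).

(** The value meets [V] as soon as the point survives the first [k] sets for
    some [k] such that [B k] meets [V]: a union of finite intersections. *)
Lemma stratum_value_lsc :
  (forall n, open (U n)) -> set_valued_lsc stratum_closed_value.
Proof.
move=> Uop V _.
have -> : meet_preimage stratum_closed_value V =
    \bigcup_(k in [set k | B k `&` V !=set0]) \bigcap_(i < k) U i.
  apply/seteqP; split=> x.
    by case=> y [[k Uk Bky] Vy]; exists k => //; exists y.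
  by case=> k [y [Bky Vy]] Uk; exists y; split => //; exists k.
apply: bigcup_open => k _; rewrite bigcap_mkord.
by elim/big_ind: _ => [||i _]; [exact: openT | exact: openI | exact: Uop].
Qed.

End StratumValue.

Lemma stratum_value_mono (X Y : topologicalType) (B : nat -> set Y)
    (U U' : nat -> set X) :
  (forall n, U n `<=` U' n) ->
  forall x, stratum_value B U x `<=` stratum_value B U' x.
Proof. by move=> UU' x y [k Uk Bky]; exists k => // i /Uk/UU'. Qed.

Lemma strictly_increasing_not_full (Y : topologicalType) (B : nat -> set Y) :
  strictly_increasing_closed_cover B -> forall n, (~` B n) !=set0.
Proof.
by case=> _ _ _ Blt n; case: (Blt n) => _ /existsNP[y /not_implyP[_ nB]]; exists y.
Qed.

(** A neighbourhood of [x] on which [psi] stays inside [B n] is disjoint from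
    the set of points at which [psi] leaves [B n]. *)
Lemma bounded_notin_closure (X Y : topologicalType) (B : nat -> set Y)
    (psi : X -> nonempty_closed_set Y) (x : X) :
  locally_bounded_map_at B psi x ->
  exists n, ~ closure (meet_preimage psi (~` B n)) x.
Proof.
case=> O Ox [n On]; exists n => /(_ O Ox)[z [[y [psiy nBy]] Oz]].
by apply: nBy; apply: On Oz _ psiy.
Qed.

Theorem theorem3p4 (X Y : topologicalType) (B : nat -> set Y)
    (hX : hausdorff_space X) (hY : hausdorff_space Y)
    (hB : strictly_increasing_closed_cover B) :
  stratifiable X <->
  exists phi : closed_set X -> lsc_map X Y,
    [/\ forall F : closed_set X,
          (F : set X) = \bigcap_n meet_preimage (phi F) (~` B n),
        forall F1 F2 : closed_set X, F1 `<=` F2 ->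
          forall x : X, phi F1 x `<=` phi F2 x
      & forall F : closed_set X, locally_bounded_map_on B (phi F) (~` F)].
Proof.
split=> [[rho [rhoF rho_mono]]|[phi [phiF phi_mono phi_bnd]]].
  pose U (F : closed_set X) n : set X := rho n F.
  exists (fun F => LscMap (stratum_value_lsc hB
    (fun n => open_setP (rho n F)) : set_valued_lsc (stratum_closed_value hB (U F)))).
  split=> [F|F1 F2 F12 x|F x nFx] /=.
  - apply/seteqP; split=> x.
      rewrite {1}(rhoF F).1 => Fx n _.
      have [y nBy] := strictly_increasing_not_full hB n.
      exists y; split => //=.
      by rewrite (stratum_value_full hB) // => k; exact: Fx.
    move=> meetx; rewrite (rhoF F).1 => n _; apply: contrapT => nUx.
    have [y [/= valy nBy]] := meetx n I.
    by apply: nBy; apply: (stratum_value_sub hB (U := U F)) nUx y valy.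
  - by apply: stratum_value_mono => n; exact: rho_mono.
  - have [n ncl] : exists n, ~ closure (U F n) x.
      apply/existsNP => cl; apply: nFx; rewrite (rhoF F).2 => n _; exact: cl.
    exists (~` closure (U F n)).
      by apply: open_nbhs_nbhs; split => //; exact/closed_openC/closed_closure.
    exists n => z nclz; apply: (stratum_value_sub hB (U := U F)).
    by move/subset_closure.
have Bop n : open (~` B n) by case: hB => Bcl _ _ _; exact/closed_openC.
exists (fun n F => OpenSet (lsc_mapP (phi F) (Bop n))).
split=> [F|F H FH n x /= [y [Fy nBy]]]; last first.
  by exists y; split => //; exact: phi_mono FH _ _ Fy.
split; first exact: phiF.
apply/seteqP; split=> x.
  by rewrite {1}phiF => Fx n _; apply: subset_closure; exact: Fx.
move=> clx; apply: contrapT => /phi_bnd /bounded_notin_closure[n].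
by apply; exact: clx.
Qed.
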